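(* For the linear crossed octagonal-quadrilateral networks $Q_n$ ($n\ge 1$), the ratio of the Kirchhoff index to the Wiener index satisfies $$\lim_{n\rightarrow\infty} \frac{Kf(Q_{n})}{W(Q_{n})}=\frac14.$$
   Context: Definition of $Q_n$ (for an integer $n\ge 1$). The linear crossed octagonal-quadrilateral network $Q_n$ is the simple undirected graph with the $8n+2$ vertices $1,2,\ldots,4n+1$ and $1',2',\ldots,(4n+1)'$, and exactly the following $18n+1$ edges: (i) $\{i,i+1\}$ and $\{i',(i+1)'\}$ for $1\le i\le 4n$; (ii) the crossing edges $\{i,(i+1)'\}$ and $\{i',i+1\}$ for $1\le i\le 4n$; (iii) the rungs $\{1,1'\}$, and $\{4k,(4k)'\}$ and $\{4k+1,(4k+1)'\}$ for $1\le k\le n$. Indices. For a simple connected graph $G$ with vertices $v_1,\ldots,v_N$, let $d_{ij}$ be the distance (length of a shortest path) between $v_i$ and $v_j$, and let $r_{ij}$ be the resistance distance, i.e. the effective resistance between $v_i$ and $v_j$ in the electrical network obtained from $G$ by placing a unit resistor on each edge. The Wiener index is $W(G)=\sum_{i<j} d_{ij}$ and the Kirchhoff index is $Kf(G)=\sum_{i<j} r_{ij}$. *)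

(* Defs.v *)
From HB Require Import structures.
From mathcomp Require Import all_boot all_order all_algebra.
From mathcomp Require Import all_classical all_reals all_analysis.
Set Implicit Arguments.
Unset Strict Implicit.
Unset Printing Implicit Defensive.
Import Order.TTheory GRing.Theory Num.Theory.
Import numFieldNormedType.Exports.
Local Open Scope ring_scope.

Record sgraph := SGraph {
  vertex :> finType;
  adj : rel vertex;
  adj_sym : symmetric adj;
  adj_irr : irreflexive adj }.

Definition has_walk (G : sgraph) (x y : G) (k : nat) : bool :=
  [exists p : k.-tuple G, path (@adj G) x p && (last x p == y)].

(* The least length of a walk from x to y.  A shortest walk has fewer than
   #|G| edges, so searching below #|G| is enough; the value is the junk #|G|
   when x and y lie in different components. *)
Definition gdist (G : sgraph) (x y : G) : nat :=
  find (has_walk x y) (iota 0 #|G|).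

(* v is the potential when a unit current enters the network at x and leaves
   at y; with unit resistors the current along an edge {z, w}, from z to w,
   is v z - v w. *)
Definition unit_current_potential (R : realType) (G : sgraph) (x y : G)
    (v : G -> R) : Prop :=
  forall z : G,
    \sum_(w : G | adj z w) (v z - v w) = (z == x)%:R - (z == y)%:R.

(* The potential is determined up to an additive constant when G is connected,
   so this set is then a singleton; the default 0 is used only when it is
   empty, that is, when x and y lie in different components. *)
Definition resistance (R : realType) (G : sgraph) (x y : G) : R :=
  xget 0 [set r | exists2 v : G -> R,
                    unit_current_potential x y v & r = v x - v y]%classic.

(* enum_rank numbers the vertices, so each unordered pair of distinct vertices
   is counted once. *)
Definition wiener (G : sgraph) : nat :=
  (\sum_(x : G) \sum_(y : G | enum_rank x < enum_rank y) gdist x y)%N.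

Definition kirchhoff (R : realType) (G : sgraph) : R :=
  \sum_(x : G) \sum_(y : G | (enum_rank x < enum_rank y)%N) resistance R x y.

Section CrossedOctagonalQuadrilateral.
Local Open Scope nat_scope.
Variable n : nat.

(* (i, false) stands for the vertex labelled i.+1, (i, true) for (i.+1)'. *)
Definition Qvertex : finType := ('I_(4 * n + 1) * bool)%type.

Definition Qlabel (x : Qvertex) : nat := x.1.+1.

Definition Qstraight : rel Qvertex := fun x y =>
  (Qlabel y == (Qlabel x).+1) && (x.2 == y.2).

Definition Qcrossing : rel Qvertex := fun x y =>
  (Qlabel y == (Qlabel x).+1) && (x.2 != y.2).

Definition Qrung : rel Qvertex := fun x y =>
  [&& Qlabel x == Qlabel y, x.2 != y.2 &
      (Qlabel x == 1) ||
      [exists k : 'I_n, (Qlabel x == 4 * k.+1) || (Qlabel x == 4 * k.+1 + 1)]].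

Definition Qadj : rel Qvertex := fun x y =>
  [|| Qstraight x y, Qstraight y x, Qcrossing x y, Qcrossing y x | Qrung x y].

Lemma Qadj_sym : symmetric Qadj.
Proof.
suff rungS x y : Qrung x y -> Qrung y x.
  move=> x y; have rungC : Qrung x y = Qrung y x.
    by apply/idP/idP; apply: rungS.
  rewrite /Qadj rungC; case: (Qstraight x y); case: (Qstraight y x) => //=.
  by case: (Qcrossing x y); case: (Qcrossing y x).
by case/and3P => /eqP xy side rung; rewrite /Qrung -xy eqxx eq_sym side.
Qed.

Lemma Qadj_irr : irreflexive Qadj.
Proof.
move=> x; rewrite /Qadj /Qstraight /Qcrossing /Qrung.
by rewrite !eqxx /= (ltn_eqF (ltnSn _)).
Qed.

Definition Qgraph : sgraph := SGraph Qadj_sym Qadj_irr.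

End CrossedOctagonalQuadrilateral.

(* Main.v *)
Require Import Defs.
From mathcomp Require Import all_boot all_order all_algebra.
From mathcomp Require Import all_classical all_reals all_analysis.
From mathcomp Require Import zify ring lra.
Import Order.TTheory GRing.Theory Num.Theory.
Import numFieldNormedType.Exports.
Local Open Scope classical_set_scope.
Local Open Scope ring_scope.

(** Consecutive columns of the network are joined completely (straight and
    crossing edges form a K_{2,2}), so both indices are governed by the
    distance between columns, |i - j| for vertices in columns i and j.

    The distance between two vertices is |i - j| except inside one column,
    where it is at most 2.  For the resistance, split a potential into its
    mean over each column and its difference between the two sides.  The mean
    sees a path whose consecutive columns are joined by four unit resistors in
    parallel, which gives |i - j| / 4.  The difference in a column does not
    interact with the other columns, because the four edges to a neighbouring
    column only see the mean there; it is created by the source and the sink in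
    their own columns, and contributes a bounded amount.  Hence the resistance
    is within a constant of a quarter of the distance, uniformly over all pairs
    and all n > 0 (lemma [resistance_near_gdist]).

    Summing over the pairs, Kf - W / 4 is at most quadratic in the number
    m = 4 n + 1 of columns ([kirchhoff_near_wiener]), whereas W grows like m ^ 3
    ([wiener_ge]); so Kf / W - 1 / 4 is O(1 / m).

    The potentials are explicit ([monopole], [laplacian_monopole]).  That a
    given potential computes the resistance follows from reciprocity, i.e. from
    the symmetry of the Laplacian ([laplacian_sym], [resistance_potential]). *)

Set Implicit Arguments.
Unset Strict Implicit.
Unset Printing Implicit Defensive.

(** * Reciprocity *)

Lemma laplacian_sym (R : realType) (G : sgraph) (u v : G -> R) :
  \sum_z u z * (\sum_(w | adj z w) (v z - v w)) =
  \sum_z v z * (\sum_(w | adj z w) (u z - u w)).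
Proof.
have E (f g : G -> R) : \sum_z f z * (\sum_(w | adj z w) (g z - g w)) =
    \sum_z \sum_(w | adj z w) f z * g z - \sum_z \sum_(w | adj z w) f z * g w.
  rewrite -sumrB; apply: eq_bigr => z _.
  by rewrite mulr_sumr -sumrB; apply: eq_bigr => w _; rewrite mulrBr.
rewrite !E; congr (_ - _).
  by apply: eq_bigr => z _; apply: eq_bigr => w _; rewrite mulrC.
rewrite (exchange_big_dep xpredT) //=; apply: eq_bigr => z _.
rewrite (eq_bigl (fun w => adj z w)); last by move=> w; rewrite adj_sym.
by apply: eq_bigr => w _; rewrite mulrC.
Qed.

Lemma sum_dipole (R : realType) (G : finType) (x y : G) (u : G -> R) :
  \sum_z u z * ((z == x)%:R - (z == y)%:R) = u x - u y.
Proof.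
have E a : \sum_z u z * (z == a)%:R = u a.
  rewrite (bigD1 a) //= eqxx mulr1 big1 ?addr0 // => z /negbTE ->.
  by rewrite mulr0.
by rewrite -[in RHS](E x) -[in RHS](E y) -sumrB; apply: eq_bigr => z _;
  rewrite mulrBr.
Qed.

(** Two potentials u and v of the same unit current give the same voltage:
    pairing u with the current of v yields u x - u y, pairing v with the current
    of u yields v x - v y, and the Laplacian is symmetric.  So any solution of
    the Kirchhoff equations may be used to evaluate the resistance. *)
Lemma resistance_potential (R : realType) (G : sgraph) (x y : G) (v : G -> R) :
  unit_current_potential x y v -> resistance R x y = v x - v y.
Proof.
move=> hv; apply: xget_unique; first by exists v.
move=> _ [u hu ->]; rewrite -(sum_dipole x y u) -(sum_dipole x y v).
transitivity (\sum_z u z * (\sum_(w | adj z w) (v z - v w))).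
  by apply: eq_bigr => z _; rewrite hv.
by rewrite laplacian_sym; apply: eq_bigr => z _; rewrite hu.
Qed.

(** * Walks and distances *)

Section Walks.
Variable G : sgraph.
Implicit Types x y z : G.

Lemma has_walk0 x : has_walk x x 0.
Proof. by apply/existsP; exists [tuple]; rewrite /= eqxx. Qed.

Lemma has_walk_cons x y z k : adj x z -> has_walk z y k -> has_walk x y k.+1.
Proof.
move=> xz /existsP[p /andP[zp lp]]; apply/existsP; exists [tuple of z :: p].
by rewrite /= xz zp.
Qed.

Lemma gdist_le_walk x y k : has_walk x y k -> (gdist x y <= k)%N.
Proof.
move=> w; rewrite leqNgt; apply/negP => lt.
have := before_find 0%N lt; rewrite nth_iota ?add0n ?w //.
by apply: leq_trans lt _; rewrite -[leqRHS](size_iota 0) find_size.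
Qed.

Lemma gdist_walk x y : (gdist x y < #|G|)%N -> has_walk x y (gdist x y).
Proof.
move=> lt; have H : has (has_walk x y) (iota 0 #|G|).
  by rewrite has_find size_iota.
by have := nth_find 0%N H; rewrite nth_iota.
Qed.

(** A lower bound on distances comes from any height that grows by at most one
    along an edge. *)
Lemma walk_lipschitz (h : G -> nat) x y k :
  (forall z w : G, adj z w -> h w <= (h z).+1)%N ->
  has_walk x y k -> (h y <= h x + k)%N.
Proof.
move=> hL /existsP[p /andP[xp /eqP <-]].
rewrite -[X in (_ + X)%N](size_tuple p).
elim: (tval p) x xp => [|z s IH] x /=; first by rewrite addn0.
by case/andP => /hL xz /IH; lia.
Qed.

End Walks.

(** * Distances in the network *)

Section Network.
Variable n : nat.
Local Notation m := (4 * n + 1)%N.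
Local Notation Q := (Qgraph n).

(** Columns are numbered from 0 here, whereas labels start at 1. *)
Definition rung_at (k : nat) : bool := (k == 0%N) ||
  [exists j : 'I_n, (k.+1 == 4 * j.+1)%N || (k.+1 == 4 * j.+1 + 1)%N].

Lemma QadjE (z w : Q) : adj z w =
  [|| w.1 == z.1.+1 :> nat, z.1 == w.1.+1 :> nat |
      [&& w.1 == z.1 :> nat, w.2 == ~~ z.2 & rung_at z.1]].
Proof.
case: z w => [i s] [j t].
rewrite /= /Qadj /Qstraight /Qcrossing /Qrung /Qlabel /= -/(rung_at i).
rewrite !eqSS [(j == i :> nat)]eq_sym.
by case: (_ == _ :> nat); case: (_ == _ :> nat); case: (_ == _ :> nat);
  case: s; case: t; rewrite ?andbF ?orbF.
Qed.

Definition coldist (x y : Q) : nat := (x.1 - y.1) + (y.1 - x.1).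

Lemma card_Q : #|Q| = (m * 2)%N.
Proof. by rewrite /= card_prod card_ord card_bool. Qed.

Lemma coldist_le_gdist (x y : Q) : (coldist x y <= gdist x y)%N.
Proof.
(* The value #|Q| of gdist stands for the absence of a walk; it exceeds every
   column distance anyway. *)
have [lt|] := ltnP (gdist x y) #|Q|; last first.
  by apply: leq_trans; rewrite card_Q /coldist; have := ltn_ord x.1;
    have := ltn_ord y.1; lia.
have x0 : coldist x x = 0%N by rewrite /coldist subnn.
rewrite -[leqRHS]add0n -x0; apply: walk_lipschitz (gdist_walk lt) => z w.
by rewrite QadjE /coldist => /or3P[/eqP|/eqP|/and3P[/eqP]]; lia.
Qed.

Hypothesis n_gt0 : (0 < n)%N.

Lemma exists_column (k : nat) : (k < m)%N -> exists z : Q, z.1 = k :> nat.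
Proof. by move=> km; exists (Ordinal km, true). Qed.

Lemma has_walk_coldist (x y : Q) k :
  coldist x y = k.+1 -> has_walk x y k.+1.
Proof.
elim: k x => [|k IH] x; rewrite /coldist => e.
  apply: has_walk_cons (has_walk0 y); rewrite QadjE.
  by apply/or3P; case: (ltngtP x.1 y.1) => c;
    [constructor 1|constructor 2|exfalso]; lia.
have [z [zx zy]] : exists z : Q, adj x z /\ coldist z y = k.+1.
  case: (ltngtP x.1 y.1) => c; last by lia.
  - have [|z zE] := @exists_column x.1.+1; first by have := ltn_ord y.1; lia.
    by exists z; rewrite QadjE /coldist zE eqxx; split => //; lia.
  - have [|z zE] := @exists_column x.1.-1; first by have := ltn_ord x.1; lia.
    exists z; rewrite QadjE /coldist zE prednK ?eqxx ?orbT; last by lia.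
    by split => //; lia.
exact: has_walk_cons zx (IH _ zy).
Qed.

(** In a single column, the two vertices are joined by a detour of length 2
    through a neighbouring column, which exists as soon as n > 0. *)
Lemma gdist_le_coldist (x y : Q) : (gdist x y <= coldist x y + 2)%N.
Proof.
case e: (coldist x y) => [|k]; last first.
  by apply: leq_trans (gdist_le_walk (has_walk_coldist e)) _; rewrite leq_addr.
have [z zE] : exists z : Q, (z.1 == x.1.+1 :> nat) || (x.1 == z.1.+1 :> nat).
  have [c|c] := ltnP x.1.+1 m.
    by have [z zE] := exists_column c; exists z; rewrite zE eqxx.
  have [|z zE] := @exists_column x.1.-1; first by have := ltn_ord x.1; lia.
  by exists z; rewrite zE prednK ?eqxx ?orbT; lia.
apply: gdist_le_walk; apply: (@has_walk_cons _ _ _ z).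
  by rewrite QadjE orbA zE.
apply: has_walk_cons (has_walk0 y); rewrite QadjE.
have xy : x.1 = y.1 :> nat by move: e; rewrite /coldist; lia.
by rewrite -xy orbA orbC [X in _ || X]orbC zE orbT.
Qed.

(** * Resistances in the network *)

Section Resistance.
Variable R : realType.

Lemma sum_column (k : nat) (f : nat -> bool -> R) :
  \sum_(w : 'I_m * bool | w.1 == k :> nat) f w.1 w.2 =
  (k < m)%:R * (f k false + f k true).
Proof.
rewrite (eq_bigl (fun w : 'I_m * bool => (w.1 == k :> nat) && xpredT w.2));
  last by move=> w; rewrite andbT.
rewrite -(pair_big (fun i : 'I_m => i == k :> nat) xpredT
  (fun i b => f i b)) /=.
have [km|km] := ltnP k m.
  rewrite (big_pred1 (Ordinal km)); last by [].
  by rewrite big_bool /= mul1r addrC.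
rewrite mul0r big_pred0 // => i; apply/negP => /eqP E.
by have := ltn_ord i; rewrite E ltnNge km.
Qed.

Lemma sum_neighbors (z : Q) (f : nat -> bool -> R) :
  \sum_(w : Q | adj z w) f w.1 w.2 =
  (z.1.+1 < m)%:R * (f z.1.+1 false + f z.1.+1 true) +
  (0 < z.1)%N%:R * (f z.1.-1 false + f z.1.-1 true) +
  (rung_at z.1)%:R * f z.1 (~~ z.2).
Proof.
rewrite -sum_column.
have -> : (0 < z.1)%N%:R * (f z.1.-1 false + f z.1.-1 true) =
  \sum_(w : 'I_m * bool | z.1 == w.1.+1 :> nat) f w.1 w.2.
  have [z0|z0] := posnP z.1.
    by rewrite z0 mul0r big_pred0 // => w; rewrite z0.
  rewrite (eq_bigl (fun w : 'I_m * bool => w.1 == z.1.-1 :> nat)).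
    by rewrite sum_column; congr (_%:R * _); have := ltn_ord z.1; lia.
  by move=> w; apply/eqP/eqP; lia.
have -> : (rung_at z.1)%:R * f z.1 (~~ z.2) =
  \sum_(w : 'I_m * bool | [&& w.1 == z.1 :> nat, w.2 == ~~ z.2 & rung_at z.1])
    f w.1 w.2.
  case: (rung_at _); last by rewrite mul0r big_pred0 // => w; rewrite !andbF.
  rewrite mul1r (big_pred1 (z.1, ~~ z.2)) // => w.
  by rewrite andbT; case: w => i t; rewrite /= xpair_eqE.
rewrite (eq_bigl _ _ (QadjE z)) (bigID (fun w : Q => w.1 == z.1.+1 :> nat)) /=.
rewrite -addrA; congr (_ + _).
  by apply: eq_bigl => w; case: (w.1 == _ :> nat); rewrite ?andbF.
rewrite (bigID (fun w : Q => z.1 == w.1.+1 :> nat)) /=; congr (_ + _);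
  apply: eq_bigl => w.
  case: (altP (z.1 =P w.1.+1 :> nat)) => e; rewrite ?andbF ?orbT //=.
  by rewrite andbT e ltn_eqF // ltnW.
case: (altP (w.1 =P z.1 :> nat)) => [e|_] /=; last first.
  by case: (w.1 == _ :> nat); case: (z.1 == _ :> nat).
have -> : (w.1 == z.1.+1 :> nat) = false by lia.
have -> : (z.1 == w.1.+1 :> nat) = false by lia.
by rewrite /= !andbT.
Qed.

Definition sgn (s t : bool) : R := if s == t then 1 else -1.

(** The eigenvalue of the Laplacian on the alternating function of column k (1
    on one side, -1 on the other, 0 in all other columns): the degree of the
    column's vertices, plus 1 when there is a rung, across which the function
    drops by 2. *)
Definition alt_conductance (k : nat) : R :=
  2 * ((k.+1 < m)%:R + (0 < k)%N%:R + (rung_at k)%:R).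

(** The potential of a unit source at x, the current leaving equally through the
    four end vertices of the network.  The first summand is the mean over
    column k: the source in column i makes it decrease by 1 / 8 per column on
    either side.  The second one is the alternating part, which the source
    excites in its own column only. *)
Definition monopole (x : Q) (k : nat) (t : bool) : R :=
  - `|k%:R - x.1%:R| / 8 +
  (if k == x.1 then sgn x.2 t / (2 * alt_conductance k) else 0).

Lemma alt_conductance_ge2 k : 2 <= alt_conductance k.
Proof.
rewrite /alt_conductance; case: k => [|k] /=.
  rewrite (_ : (1 < m)%N); last by lia.
  by rewrite /=; lra.
by case: (_ < _)%N; case: (rung_at _) => /=; lra.
Qed.

(** Neighbouring columns only see the mean of a column: the alternating part
    cancels. *)
Lemma monopole_column (x : Q) k :
  monopole x k false + monopole x k true = - `|k%:R - x.1%:R| / 4.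
Proof.
rewrite /monopole; case: (_ == _); last by rewrite !addr0; lra.
suff -> : sgn x.2 true = - sgn x.2 false by rewrite mulNr; lra.
by rewrite /sgn; case: x.2; rewrite ?opprK.
Qed.

(** The net current is 1 at x and - 1 / 4 at each of the four end vertices.  The
    outflow at the ends does not depend on x, so that it cancels in the
    difference of two monopoles. *)
Lemma laplacian_monopole (x z : Q) :
  \sum_(w : Q | adj z w) (monopole x z.1 z.2 - monopole x w.1 w.2) =
  (z == x)%:R - ((z.1 == 0%N :> nat)%:R + (z.1.+1 == m)%:R) / 4.
Proof.
rewrite (sum_neighbors z (fun k t => monopole x z.1 z.2 - monopole x k t)).
set M := monopole x z.1 z.2.
have column k : M - monopole x k false + (M - monopole x k true) =
    2 * M + `|k%:R - x.1%:R| / 4.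
  by have := monopole_column x k; lra.
rewrite !column.
have -> : monopole x z.1 (~~ z.2) = - `|z.1%:R - x.1%:R| / 4 - M.
  by rewrite -monopole_column /M; case: z.2; lra.
rewrite /M {M column}.
have -> : (z == x) = (z.1 == x.1 :> nat) && (x.2 == z.2).
  by case: z x => [a b] [c d]; rewrite xpair_eqE /= [d == b]eq_sym -val_eqE.
have km := ltn_ord z.1; have im := ltn_ord x.1.
have -> : (z.1 == 0%N :> nat)%:R = 1 - (0 < z.1)%N%:R :> R.
  by case: posnP => _ /=; lra.
have -> : (z.1.+1 == m)%:R = 1 - (z.1.+1 < m)%N%:R :> R.
  by rewrite ltn_neqAle km andbT; case: (_ == _); rewrite /= ; lra.
rewrite /monopole.
have predE : (0 < z.1)%N -> z.1%:R = z.1.-1%:R + 1 :> R.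
  by move=> k0; rewrite natr1 prednK.
(* Away from the column of x the mean is linear, and only the end columns
   carry current; in that column the kink of the mean provides 1 / 2 and the
   alternating part provides + 1 / 2 or - 1 / 2. *)
case: (ltngtP z.1 x.1) => [lt|gt|eq] /=.
- have -> : (z.1.+1 < m)%N by lia.
  have h : z.1%:R + 1 <= x.1%:R :> R by rewrite natr1 ler_nat.
  have p : z.1.-1%:R <= z.1%:R :> R by rewrite ler_nat leq_pred.
  rewrite -[z.1.+1%:R]natr1 !ler0_norm; try by lra.
  case: posnP => [->|/predE ->] /=; by field.
- have z0 : (0 < z.1)%N := leq_ltn_trans (leq0n _) gt.
  have h : x.1%:R + 1 <= z.1%:R :> R by rewrite natr1 ler_nat.
  have e := predE z0; rewrite z0.
  rewrite -[z.1.+1%:R]natr1 !ger0_norm; try by lra.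
  by rewrite e; case: (_ < _)%N => /=; field.
- rewrite -eq subrr normr0.
  have -> : `|z.1.+1%:R - z.1%:R| = 1 :> R.
    by rewrite -[z.1.+1%:R]natr1 addrAC subrr add0r normr1.
  have left_step c : (0 < z.1)%N%:R * (c + `|z.1.-1%:R - z.1%:R| / 4) =
      (0 < z.1)%N%:R * (c + 1 / 4) :> R.
    case: posnP predE => [_ _|k0 /(_ isT) ->]; first by rewrite !mul0r.
    by rewrite opprD addrA subrr sub0r normrN normr1.
  rewrite left_step.
  have ge2 := alt_conductance_ge2 z.1.
  have D0 : alt_conductance z.1 != 0 by rewrite gt_eqF //; lra.
  have -> : (x.2 == z.2)%:R = (sgn x.2 z.2 + 1) / 2.
    by rewrite /sgn; case: (_ == _) => /=; lra.
  set e := sgn _ _; set c := e / (2 * _).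
  have -> : e = c * (2 * alt_conductance z.1) by rewrite /c; field.
  by rewrite /alt_conductance; field.
Qed.

Lemma resistance_monopole (x y : Q) : resistance R x y =
  (monopole x x.1 x.2 - monopole y x.1 x.2) -
  (monopole x y.1 y.2 - monopole y y.1 y.2).
Proof.
apply: (resistance_potential (v := fun z : Q =>
  monopole x z.1 z.2 - monopole y z.1 z.2)) => z.
rewrite (eq_bigr (fun w : Q => (monopole x z.1 z.2 - monopole x w.1 w.2) -
  (monopole y z.1 z.2 - monopole y w.1 w.2))); last by move=> w _; ring.
by rewrite sumrB !laplacian_monopole; ring.
Qed.

(** The mean parts of the two monopoles give exactly |i - j| / 4; each of the
    four alternating terms is at most 1 / 4, since its denominator is at least
    4. *)
Lemma resistance_near_coldist (x y : Q) :
  `|resistance R x y - (coldist x y)%:R / 4| <= 1.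
Proof.
have bnd (k : nat) (s t : bool) (b : bool) :
    `|if b then sgn s t / (2 * alt_conductance k) else 0| <= 1 / 4.
  case: b; last by rewrite normr0; lra.
  have ge2 := alt_conductance_ge2 k.
  have D0 : 0 < 2 * alt_conductance k by lra.
  rewrite normrM normfV (gtr0_norm D0) ler_pdivrMr //.
  suff -> : `|sgn s t| = 1 by lra.
  by rewrite /sgn; case: eqP => _; rewrite ?normrN normr1.
have cd : (coldist x y)%:R = `|x.1%:R - y.1%:R| :> R.
  rewrite /coldist; case: (leqP x.1 y.1) => h.
    rewrite distrC ger0_norm ?subr_ge0 ?ler_nat // -natrB //.
    by congr _%:R; lia.
  rewrite ger0_norm ?subr_ge0 ?ler_nat 1?ltnW // -natrB 1?ltnW //.
  by congr _%:R; lia.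
rewrite resistance_monopole /monopole cd !subrr normr0 [`|y.1%:R - _|]distrC.
have := bnd x.1 x.2 x.2 (x.1 == x.1 :> nat).
have := bnd x.1 y.2 x.2 (x.1 == y.1 :> nat).
have := bnd y.1 x.2 y.2 (y.1 == x.1 :> nat).
have := bnd y.1 y.2 y.2 (y.1 == y.1 :> nat).
do 4![move: (if _ then _ else _) => ?].
by rewrite !ler_norml => /andP[? ?] /andP[? ?] /andP[? ?] /andP[? ?]; lra.
Qed.

Lemma resistance_near_gdist (x y : Q) :
  `|resistance R x y - (gdist x y)%:R / 4| <= 3 / 2.
Proof.
have := resistance_near_coldist x y.
have : (coldist x y)%:R <= (gdist x y)%:R :> R.
  by rewrite ler_nat coldist_le_gdist.
have : (gdist x y)%:R <= (coldist x y)%:R + 2 :> R.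
  by rewrite -natrD ler_nat gdist_le_coldist.
by rewrite !ler_norml => ? ? /andP[? ?]; lra.
Qed.

(** The constant is 3 / 2 times the (2 m) ^ 2 ordered pairs, a crude upper bound
    for the number of unordered ones. *)
Lemma kirchhoff_near_wiener :
  `|kirchhoff R Q - (wiener Q)%:R / 4| <= 6 * m%:R ^+ 2.
Proof.
have -> : (wiener Q)%:R / 4 = \sum_(x : Q) \sum_(y : Q |
    (enum_rank x < enum_rank y)%N) (gdist x y)%:R / 4 :> R.
  rewrite natr_sum mulr_suml; apply: eq_bigr => x _.
  by rewrite natr_sum mulr_suml.
rewrite -sumrB; apply: le_trans (ler_norm_sum _ _ _) _.
have -> : 6 * m%:R ^+ 2 = \sum_(x : Q) \sum_(y : Q) 3 / 2 :> R.
  rewrite !sumr_const -mulrnA -[#|_|]/#|Q| card_Q -(mulr_natr (3 / 2)) !natrM.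
  by field.
apply: ler_sum => x _; rewrite -sumrB; apply: le_trans (ler_norm_sum _ _ _) _.
rewrite [leRHS](bigID (fun y : Q => enum_rank x < enum_rank y)%N) /=.
rewrite -[leLHS]addr0 lerD //.
  by apply: ler_sum => y _; exact: resistance_near_gdist.
by apply: sumr_ge0 => y _; lra.
Qed.

End Resistance.

End Network.

(** * Cubic growth of the Wiener index *)

(** The closed form is (m ^ 3 - m) / 3; it is cleared of denominators and of the
    truncated subtraction. *)
Lemma sum_line_dist m :
  (3 * (\sum_(i < m) \sum_(j < m) ((i - j) + (j - i))) + m = m ^ 3)%N.
Proof.
elim: m => [|m IH]; first by rewrite big_ord0.
rewrite big_ord_recr /= big_ord_recr /= subnn !addn0.
under eq_bigr => i _ do rewrite big_ord_recr /=.
rewrite big_split /=.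
have side : (2 * (\sum_(i < m) ((i - m) + (m - i))) = m * m.+1)%N.
  elim: m {IH} => [|m IH]; first by rewrite big_ord0.
  rewrite big_ord_recl /= subn0 sub0n.
  under eq_bigr => i _ do rewrite /bump !add1n !subSS.
  by rewrite mulnDr IH; lia.
have side' : (\sum_(i < m) ((m - i) + (i - m)) =
    \sum_(i < m) ((i - m) + (m - i)))%N by apply: eq_bigr => i _; rewrite addnC.
rewrite side'; move: IH side; move: (\sum_(i < m) _)%N (\sum_(i < m) _)%N.
by move=> a b; rewrite !expnS !expn0; nia.
Qed.

Lemma sum_unordered_pairs (T : finType) (f : T -> T -> nat) :
  (forall x, f x x = 0%N) -> (forall x y, f x y = f y x) ->
  (\sum_x \sum_y f x y =
   2 * \sum_x \sum_(y | enum_rank x < enum_rank y) f x y)%N.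
Proof.
move=> f0 fC.
have fE x : (\sum_y f x y = \sum_(y | enum_rank x < enum_rank y) f x y +
    \sum_(y | enum_rank y < enum_rank x) f x y)%N.
  rewrite (bigID (fun y => enum_rank x < enum_rank y)%N) /=; congr (_ + _)%N.
  rewrite (bigD1 x) /= ?ltnn // f0 add0n; apply: eq_bigl => y.
  by rewrite -leqNgt ltn_neqAle andbC val_eqE (inj_eq enum_rank_inj).
under eq_bigr => x _ do rewrite fE.
rewrite big_split /= mul2n -addnn; congr (_ + _)%N.
rewrite (exchange_big_dep xpredT) //=.
by apply: eq_bigr => y _; apply: eq_bigr => x _; rewrite fC.
Qed.

(** Each pair of columns carries 4 ordered pairs of vertices, so the column
    distances add up to 4 (m ^ 3 - m) / 3 over the ordered pairs, and the Wiener
    index is at least half of this. *)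
Lemma wiener_ge n :
  (4 * (4 * n + 1) ^ 3 <= 6 * wiener (Qgraph n) + 4 * (4 * n + 1))%N.
Proof.
have total : (\sum_(x : Qgraph n) \sum_(y : Qgraph n) coldist x y =
    4 * \sum_(i < 4 * n + 1) \sum_(j < 4 * n + 1) ((i - j) + (j - i)))%N.
  have pairs (f : 'I_(4 * n + 1) -> nat) :
      (\sum_(x : Qgraph n) f x.1 = 2 * \sum_i f i)%N.
    rewrite -(pair_big xpredT xpredT (fun i (_ : bool) => f i)) /= big_distrr.
    by apply: eq_bigr => i _; rewrite big_bool /= addnn mul2n.
  under eq_bigr => x _ do
    rewrite /coldist (pairs (fun j => x.1 - j + (j - x.1))%N).
  rewrite (pairs (fun i => 2 * \sum_(j < 4 * n + 1) (i - j + (j - i)))%N).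
  by rewrite -big_distrr mulnA.
have := sum_line_dist (4 * n + 1).
suff : (\sum_(x : Qgraph n) \sum_(y : Qgraph n) coldist x y <=
    2 * wiener (Qgraph n))%N by rewrite total; lia.
rewrite sum_unordered_pairs => [|x|x y]; last 2 first.
- by rewrite /coldist subnn.
- by rewrite /coldist addnC.
rewrite leq_mul2l; apply: leq_sum => x _; apply: leq_sum => y _.
exact: coldist_le_gdist.
Qed.

(** * The limit *)

Theorem theorem3p3 (R : realType) :
  (kirchhoff R (Qgraph n) / (wiener (Qgraph n))%:R : R) @[n --> \oo]
    --> (1 / 4 : R).
Proof.
have h0 (s : R) : (1 / 4 + s * harmonic n : R) @[n --> \oo] --> (1 / 4 : R).
  rewrite -[X in _ --> X]addr0 -[X in _ + X](mulr0 s).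
  by apply: cvgD; [exact: cvg_cst|apply: cvgMr; exact: cvg_harmonic].
apply: (squeeze_cvgr _ (h0 (- 12)) (h0 12)).
near=> n; have n_gt0 : (0 < n)%N by near: n; exists 1%N.
set K := kirchhoff R _; set W := wiener _.
pose M : R := (4 * n + 1)%N%:R.
have M5 : 5 <= M by rewrite ler_nat; lia.
have WM : 4 * M ^+ 3 <= 6 * W%:R + 4 * M.
  by rewrite /M -natrX -!natrM -natrD ler_nat wiener_ge.
have W_ge : M ^+ 3 / 2 <= W%:R.
  suff : 4 * M <= M ^+ 3 by lra.
  by rewrite exprSr ler_wpM2r //; nra.
have W0 : 0 < W%:R :> R.
  by apply: lt_le_trans W_ge; rewrite divr_gt0 ?exprn_gt0; lra.
(* |K / W - 1 / 4| is at most 6 M ^ 2 / (M ^ 3 / 2). *)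
have near_quarter : `|K / W%:R - 1 / 4| <= 12 / M.
  have -> : K / W%:R - 1 / 4 = (K - W%:R / 4) / W%:R by field; rewrite gt_eqF.
  rewrite normrM normfV (gtr0_norm W0) ler_pdivrMr //.
  apply: le_trans (kirchhoff_near_wiener n_gt0 R) _.
  have -> : 6 * M ^+ 2 = 12 / M * (M ^+ 3 / 2).
    by field; rewrite gt_eqF //; lra.
  by rewrite ler_wpM2l // divr_ge0; lra.
have harm : 12 / M <= 12 * harmonic n.
  apply: ler_wpM2l => //=.
  have nM : n.+1%:R <= M by rewrite ler_nat; lia.
  by rewrite /harmonic lef_pV2 ?posrE ?ltr0n ?addn1.
by move: near_quarter; rewrite ler_norml => /andP[? ?]; apply/andP; split; lra.
Unshelve. all: by end_near.
Qed.
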